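(* Let $x,y$ be real numbers with $y > x \geq 0$. Then, as semirings, \[\mathbb{T}_{[x,y]} \ \cong \ \begin{cases} \mathbb{T}_{[0,1]} \ \ &\textrm{ if } x = 0; \\ \mathbb{T}_{[1,2]} \ \ &\textrm{ if } x > 0 \textrm{ and } y \leq 2x; \\ \mathbb{T}_{[1,2.5]} \ \ &\textrm{ if } x > 0 \textrm{ and } 2x < y < 3x; \\ \mathbb{T}_{[1,\frac{y}{x}]} &\textrm{ if } x > 0 \textrm{ and } y \geq 3x. \end{cases} \] Moreover, the semirings $\mathbb{T}_{[0,1]}$, $\mathbb{T}_{[1,2]}$, $\mathbb{T}_{[1,2.5]}$ and $\mathbb{T}_{[1,y]}$ for real $y \geq 3$ are pairwise non-isomorphic (in particular $\mathbb{T}_{[1,y]}\not\cong\mathbb{T}_{[1,z]}$ for distinct $y,z\geq 3$).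
   Context: For real numbers $0\leq x<y$, the truncated tropical semiring $\mathbb{T}_{[x,y]}$ has underlying set $[x,y]\cup\{0,-\infty\}$, where $[x,y]$ is the real interval; its semiring addition is maximum and its semiring multiplication is $y$-truncated addition $(a,b)\mapsto\min(a+b,y)$, where $+$ is classical addition (with $-\infty+a=-\infty$). Isomorphisms are bijections preserving semiring addition and multiplication. *)

(* Defs.v *)
From HB Require Import structures.
From mathcomp Require Import all_boot all_order all_algebra.
From mathcomp Require Import reals constructive_ereal.
From mathcomp Require Import lra.
Set Implicit Arguments.
Unset Strict Implicit.
Unset Printing Implicit Defensive.
Import Order.TTheory GRing.Theory Num.Theory.
Local Open Scope ring_scope.

Section TruncatedTropical.
Variable R : realType.
Implicit Types (x y : R) (a b c : \bar R).

Definition trop_elt x y : pred (\bar R) :=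
  fun a => [|| (x%:E <= a <= y%:E)%E, a == 0%E | a == -oo%E].

Lemma trop_elt_zero x y : trop_elt x y -oo%E.
Proof. by rewrite /trop_elt eqxx !orbT. Qed.

Lemma trop_elt_one x y : trop_elt x y 0%E.
Proof. by rewrite /trop_elt eqxx !orbT. Qed.

Lemma trop_elt_max x y a b :
  trop_elt x y a -> trop_elt x y b -> trop_elt x y (maxe a b).
Proof. by move=> Ta Tb; case: (leP a b). Qed.

Lemma trop_eltP x y a : 0 <= x < y -> trop_elt x y a ->
  [\/ a = -oo%E, a = 0%E | exists2 r, a = r%:E & x <= r <= y].
Proof.
move=> _; case/or3P=> [|/eqP->|/eqP->];
  [ | by constructor 2 | by constructor 1].
by case: a => [r| |]; rewrite ?leey ?leNye ?lee_fin => // h; constructor 3; exists r.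
Qed.

Lemma trop_elt_mul x y a b : 0 <= x < y ->
  trop_elt x y a -> trop_elt x y b -> trop_elt x y (mine (a + b)%E y%:E).
Proof.
move=> h; have /andP[x0 xy] := h.
have y0 : 0 <= y by lra.
have TNy : trop_elt x y (mine -oo%E y%:E).
  by rewrite min_l ?leNye//; exact: trop_elt_zero.
have Tr r : x <= r -> trop_elt x y (mine r%:E y%:E).
  by move=> xr; rewrite /trop_elt le_min ge_min !lee_fin lexx xr (ltW xy) orbT.
move=> /(trop_eltP h)[->|->|[r -> /andP[xr ry]]].
- by rewrite addNye.
- move=> /(trop_eltP h)[->|->|[s -> /andP[xs sy]]]; rewrite add0e //.
    by rewrite min_l ?lee_fin//; exact: trop_elt_one.
  exact: Tr.
- move=> /(trop_eltP h)[->|->|[s -> /andP[xs sy]]].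
  + by rewrite addeNy.
  + by rewrite adde0; exact: Tr.
  + by rewrite -EFinD; apply: Tr; lra.
Qed.

(* The well-formedness proof is part of the type because closure under
   truncated addition fails for arbitrary x and y. *)
Record trunc_trop x y (h : 0 <= x < y) := TruncTrop {
  trop_val : \bar R;
  trop_valP : trop_elt x y trop_val }.

HB.instance Definition _ x y h := [isSub for @trop_val x y h].
HB.instance Definition _ x y h := [Choice of trunc_trop (x:=x) (y:=y) h by <:].

Section Semiring.
Variables (x y : R) (h : 0 <= x < y).
Local Notation T := (trunc_trop h).

Definition trop_zero : T := TruncTrop h (trop_elt_zero x y).
Definition trop_one : T := TruncTrop h (trop_elt_one x y).
Definition trop_add (a b : T) : T :=
  TruncTrop h (trop_elt_max (trop_valP a) (trop_valP b)).
Definition trop_mul (a b : T) : T :=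
  TruncTrop h (trop_elt_mul h (trop_valP a) (trop_valP b)).

Lemma trop_addA : associative trop_add.
Proof. by move=> a b c; apply: val_inj; rewrite /= maxA. Qed.
Lemma trop_addC : commutative trop_add.
Proof. by move=> a b; apply: val_inj; rewrite /= maxC. Qed.
Lemma trop_add0 : left_id trop_zero trop_add.
Proof. by move=> a; apply: val_inj; rewrite /= max_r ?leNye. Qed.

Lemma trop_le (a : T) : (trop_val a <= y%:E)%E.
Proof.
have /andP[x0 xy] := h.
by case: (trop_eltP h (trop_valP a)) => [->|->|[r -> /andP[_ ry]]];
  rewrite ?leNye ?lee_fin //; lra.
Qed.

Lemma trop_mulC : commutative trop_mul.
Proof. by move=> a b; apply: val_inj; rewrite /= addeC. Qed.

Let truncD a b c : c = -oo%E \/ (0 <= c)%E ->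
  mine (mine (a + b) y%:E + c)%E y%:E = mine (a + b + c)%E y%:E.
Proof.
case=> [->|c0]; first by rewrite !addeNy.
case: (leP (a + b)%E y%:E) => // ylt.
by rewrite !min_r // ?leeDl // (le_trans (ltW ylt)) // leeDl.
Qed.

Let trop_ge0 (a : T) : trop_val a = -oo%E \/ (0 <= trop_val a)%E.
Proof.
have /andP[x0 xy] := h.
case: (trop_eltP h (trop_valP a)) => [->|->|[r -> /andP[xr _]]];
  [by left | by right | by right; rewrite lee_fin; lra].
Qed.

Lemma trop_mulA : associative trop_mul.
Proof.
move=> a b c; apply: val_inj => /=.
rewrite addeC !truncD; try exact: trop_ge0.
by rewrite addeC addeA.
Qed.
Lemma trop_mul1 : left_id trop_one trop_mul.
Proof. by move=> a; apply: val_inj; rewrite /= add0e min_l ?trop_le. Qed.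
Lemma trop_mulDl : left_distributive trop_mul trop_add.
Proof. by move=> a b c; apply: val_inj; rewrite /= adde_maxl min_maxl. Qed.
Lemma trop_mul0 : left_zero trop_zero trop_mul.
Proof. by move=> a; apply: val_inj; rewrite /= addNye min_l ?leNye. Qed.
Lemma trop_one_neq0 : trop_one != trop_zero.
Proof. by []. Qed.

HB.instance Definition _ :=
  GRing.isNmodule.Build T trop_addA trop_addC trop_add0.
HB.instance Definition _ := GRing.Nmodule_isComNzSemiRing.Build T
  trop_mulA trop_mulC trop_mul1 trop_mulDl trop_mul0 trop_one_neq0.

Lemma trop_val0 : trop_val (0 : T) = -oo%E. Proof. by []. Qed.
Lemma trop_val1 : trop_val (1 : T) = 0%E. Proof. by []. Qed.
Lemma trop_valD (a b : T) : trop_val (a + b) = maxe (trop_val a) (trop_val b).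
Proof. by []. Qed.
Lemma trop_valM (a b : T) :
  trop_val (a * b) = mine (trop_val a + trop_val b)%E y%:E.
Proof. by []. Qed.
End Semiring.

Lemma bounds_0_1 : 0 <= (0 : R) < 1.
Proof. by apply/andP; split; lra. Qed.
Lemma bounds_1_2 : 0 <= (1 : R) < 2.
Proof. by apply/andP; split; lra. Qed.
Lemma bounds_1_52 : 0 <= (1 : R) < 5 / 2.
Proof. by apply/andP; split; lra. Qed.
Lemma bounds_1_ge3 y : 3 <= y -> 0 <= (1 : R) < y.
Proof. by move=> y3; apply/andP; split; lra. Qed.
Lemma bounds_1_div x y : 0 < x -> 3 * x <= y -> 0 <= (1 : R) < y / x.
Proof. by move=> x0 xy; apply: bounds_1_ge3; rewrite ler_pdivlMr. Qed.

End TruncatedTropical.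

Arguments trunc_trop {R} x y h.

Definition semiring_iso (S S' : pzSemiRingType) : Prop :=
  exists f : S -> S',
    [/\ bijective f, {morph f : a b / a + b} & {morph f : a b / a * b}].

Notation "S ≅ S'" := (semiring_iso S S') (at level 70, no associativity).

(* Main.v *)
Require Import Defs.
From mathcomp Require Import all_boot all_order all_algebra.
From mathcomp Require Import reals constructive_ereal archimedean.
From mathcomp Require Import ring lra.
Import Order.TTheory GRing.Theory Num.Theory.
Local Open Scope ring_scope.

(** Everything happens on the carrier minus its zero: the set consisting of 0
and of the real interval [x, y], with the usual order and addition truncated
at y.  Semiring addition is the maximum, so a semiring isomorphism is the same
thing as an order isomorphism that respects truncated addition.

Isomorphisms are built from increasing bijections phi of the real line that fix
0 and send x, y to x', y' (iso_of_order_auto).  Multiplication by a constant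
settles x = 0 and y >= 3x.  When y <= 2x, two elements of [x, y] always add up
to at least y, so any phi will do (iso_two_layers).  When 2x < y < 3x, only
elements of [x, y - x] have sums below y, and these sums lie in [2x, y], an
interval disjoint from [x, y - x].  Hence phi only has to be affine, with a
common slope, on these two intervals and may bridge the gap between them
arbitrarily (iso_three_layers).

Conversely an isomorphism yields such a phi on the carrier (iso_coordinates);
it fixes 0 and preserves the top element and, if x, x' > 0, the least element
of the interval.  This separates the four families:
- T_[0,1] has no least element above 0, the others have one (not_iso_dense);
- in T_[1,2] the least element m of the interval satisfies m + m = top, which
  fails once y > 2 (not_iso_two_layers);
- in T_[1,5/2] the element 3/2 lies below m + m and yet reaches the top when m
  is added; for y >= 3 no element below m + m does (not_iso_three_layers).

Finally let 3 <= y < z and suppose phi maps T_[1,y] to T_[1,z].  Then phi fixes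
1 and 2.  For k < N the sums (1 + (k + 1) / N) + 1 and (1 + k / N) + (1 + 1 / N)
agree, and the image of the first is at most 3, so it is not truncated at z.
Therefore phi is affine on the points 1 + k / N and fixes them (coord_rational).
With n the integer part of y, one of these fixed points c satisfies y < n c < z:
its n-th power is the top element in the source but not in the target.  Thus
z <= y (iso_bound_le), and by symmetry y = z. *)

(** * Increasing bijections of the real line *)

Lemma mono_min {d d' : Order.disp_t} {T : orderType d} {T' : orderType d'}
    {f : T -> T'} : {mono f : a b / (a <= b)%O} ->
  {morph f : a b / Order.min a b}.
Proof. by move=> mono_f a b; rewrite !minElt (leW_mono mono_f) -fun_if. Qed.

Lemma mono_max {d d' : Order.disp_t} {T : orderType d} {T' : orderType d'}
    {f : T -> T'} : {mono f : a b / (a <= b)%O} ->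
  {morph f : a b / Order.max a b}.
Proof. by move=> mono_f a b; rewrite !maxElt (leW_mono mono_f) -fun_if. Qed.

Section OrderAutomorphisms.
Context {R : realType}.
Implicit Types (c p q r s x y : R) (phi psi : R -> R).

Definition order_auto phi := {mono phi : a b / a <= b} /\ bijective phi.

Lemma order_autoP phi : {homo phi : a b / a < b} ->
  (forall r, exists s, phi s = r) -> order_auto phi.
Proof.
move=> lt_phi surj; have mono_phi := le_mono lt_phi; split=> //.
have surjb r : exists s, phi s == r by have [s <-] := surj r; exists s.
pose psi r := xchoose (surjb r).
have psiK : cancel psi phi by move=> r; apply/eqP/(xchooseP (surjb r)).
by exists psi => // r; apply: (inc_inj mono_phi); rewrite psiK.
Qed.

(** The affine map of slope s through the point (p, q). *)
Definition line p q s r := q + s * (r - p).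

Lemma line_auto p q s : 0 < s -> order_auto (line p q s).
Proof.
move=> s0; apply: order_autoP => [a b ab | r].
  by rewrite /line ltrD2l ltr_pM2l // ltrD2r.
by exists (line q p s^-1 r); rewrite /line; field; rewrite gt_eqF.
Qed.

Definition glue c phi psi r := if r <= c then phi r else psi r.

Lemma glue_l c phi psi r : r <= c -> glue c phi psi r = phi r.
Proof. by rewrite /glue => ->. Qed.

Lemma glue_r c phi psi r : phi c = psi c -> c <= r -> glue c phi psi r = psi r.
Proof.
by rewrite /glue => agree; rewrite le_eqVlt => /predU1P[<-|/lt_geF ->] //;
  rewrite lexx.
Qed.

(** A value r is attained by phi or by psi according to its position relative to
the common value at c. *)
Lemma glue_auto c phi psi : phi c = psi c ->
  order_auto phi -> order_auto psi -> order_auto (glue c phi psi).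
Proof.
move=> agree [mono_phi [phi' phi'K phiK]] [mono_psi [psi' psi'K psiK]].
apply: order_autoP => [a b ab | r].
  have [bc|cb] := leP b c.
    by rewrite !glue_l ?(leW_mono mono_phi) // (le_trans (ltW ab)).
  have [ac|ca] := leP a c.
    rewrite glue_l // glue_r ?(ltW cb) //.
    apply: (@le_lt_trans _ _ (phi c)); first by rewrite mono_phi.
    by rewrite agree (leW_mono mono_psi).
  by rewrite !glue_r ?(ltW ca) ?(ltW cb) // (leW_mono mono_psi).
have [rc|cr] := leP r (phi c).
  by exists (phi' r); rewrite glue_l ?phiK // -mono_phi phiK.
by exists (psi' r); rewrite glue_r ?psiK // -mono_psi psiK -agree ltW.
Qed.

End OrderAutomorphisms.

(** * Isomorphisms induced by increasing bijections *)

Section FromRealMaps.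
Context {R : realType}.
Implicit Types (x y : R) (phi : R -> R).

Lemma er_map_mono {phi} : {mono phi : a b / a <= b} ->
  {mono er_map phi : a b / (a <= b)%E}.
Proof.
by move=> mono_phi [a||] [b||] //=; rewrite ?leey ?leNye ?lee_fin ?mono_phi.
Qed.

(** The map er_map phi fixes -oo, so the conditions at 0, x and y make it carry
one carrier onto the other.  It preserves maxima because it is increasing, and
products with the zero or the unit are preserved because it fixes both; only
truncated sums of two elements of the interval remain as a hypothesis. *)
Lemma iso_of_order_auto {x y x' y'} (h : 0 <= x < y) (h' : 0 <= x' < y') {phi} :
    order_auto phi -> phi 0 = 0 -> phi x = x' -> phi y = y' ->
    (forall a b, x <= a <= y -> x <= b <= y ->
       Num.min (phi (a + b)) y' = Num.min (phi a + phi b) y') ->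
  trunc_trop x y h ≅ trunc_trop x' y' h'.
Proof.
move=> auto_phi phi0 phix phiy trunc; have [mono_phi bij_phi] := auto_phi.
have monoE := er_map_mono mono_phi.
have elt_phi a : trop_elt x' y' (er_map phi a) = trop_elt x y a.
  rewrite /trop_elt.
  have -> : x'%:E = er_map phi x%:E by rewrite /= phix.
  have -> : y'%:E = er_map phi y%:E by rewrite /= phiy.
  have -> : 0%E = er_map phi 0%:E by rewrite /= phi0.
  rewrite !monoE (inj_eq (inc_inj monoE)) /= phi0; congr [|| _, _ | _].
  by case: a.
have [psi phiK psiK] := bij_phi.
have psiKE : cancel (er_map psi) (er_map phi) by case=> //= r; rewrite psiK.
have phiKE : cancel (er_map phi) (er_map psi) by case=> //= r; rewrite phiK.
have eltF (a : trunc_trop x y h) : trop_elt x' y' (er_map phi (trop_val a)).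
  by rewrite elt_phi; exact: trop_valP.
have eltG (b : trunc_trop x' y' h') : trop_elt x y (er_map psi (trop_val b)).
  by rewrite -elt_phi psiKE; exact: trop_valP.
exists (fun a => TruncTrop h' (eltF a)); split.
- exists (fun b => TruncTrop h (eltG b)) => a; apply: val_inj => /=.
    exact: phiKE.
  exact: psiKE.
- by move=> a b; apply: val_inj => /=; rewrite (mono_max monoE).
move=> a b; apply: val_inj => /=.
rewrite (mono_min monoE) /= phiy.
case: (trop_eltP h (trop_valP a)) => [->|->|[r -> xry]] /=.
- by rewrite !addNye.
- by rewrite phi0 !add0e.
case: (trop_eltP h (trop_valP b)) => [->|->|[s -> xsy]] /=.
- by rewrite !addeNy.
- by rewrite phi0 addr0 adde0.
by rewrite -!EFinD -!EFin_min trunc.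
Qed.

Lemma iso_scale (s x y x' y' : R) (h : 0 <= x < y) (h' : 0 <= x' < y') :
  0 < s -> x' = s * x -> y' = s * y ->
  trunc_trop x y h ≅ trunc_trop x' y' h'.
Proof.
move=> s0 xE yE; apply: (iso_of_order_auto _ _ (phi := line 0 0 s)).
- exact: line_auto.
- by rewrite /line; lra.
- by rewrite /line; lra.
- by rewrite /line; lra.
- by move=> a b _ _; congr Num.min; rewrite /line; ring.
Qed.

(** All products of two elements of the interval are equal to the top on either
side, so any increasing bijection with the right values at 0, x and y works. *)
Lemma iso_two_layers (x y : R) (h : 0 <= x < y) : 0 < x -> y <= 2 * x ->
  trunc_trop x y h ≅ trunc_trop 1 2 (bounds_1_2 R).
Proof.
move=> x0 y2x; have /andP[_ xy] := h; have yx0 : 0 < y - x by lra.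
pose phi := glue x (line 0 0 x^-1) (line x 1 (y - x)^-1).
have agree : line 0 0 x^-1 x = line x 1 (y - x)^-1 x.
  by rewrite /line; field; rewrite !gt_eqF.
have auto_phi : order_auto phi.
  by apply: glue_auto => //; apply: line_auto; rewrite invr_gt0.
have phix : phi x = 1 by rewrite /phi glue_r // /line; lra.
have phiy : phi y = 2.
  by rewrite /phi glue_r ?(ltW xy) // /line mulVf ?gt_eqF //; lra.
apply: (iso_of_order_auto _ _ auto_phi) => //.
  by rewrite /phi glue_l ?(ltW x0) // /line; lra.
have [mono_phi _] := auto_phi.
move=> a b /andP[xa _] /andP[xb _]; rewrite !min_r //.
  by have := mono_phi x a; have := mono_phi x b; rewrite phix xa xb; lra.
by rewrite -phiy mono_phi; lra.
Qed.

(** The broken line phi has corners (x, 1), (y - x, 3/2) and (2x, 2) and passes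
through (y, 5/2).  Both segments over [x, y - x] and [2x, y] have slope s, which
makes phi compatible with sums of elements of [x, y - x].  If a or b exceeds
y - x, then both sums exceed the top. *)
Lemma iso_three_layers (x y : R) (h : 0 <= x < y) :
  0 < x -> 2 * x < y -> y < 3 * x ->
  trunc_trop x y h ≅ trunc_trop 1 (5 / 2) (bounds_1_52 R).
Proof.
move=> x0 x2y y3x; have /andP[_ xy] := h.
pose s := (2 * (y - 2 * x))^-1; pose t := (2 * (3 * x - y))^-1.
have s0 : 0 < s by rewrite invr_gt0; lra.
have t0 : 0 < t by rewrite invr_gt0; lra.
have sE : s * (y - 2 * x) = 1 / 2 by rewrite /s; field; rewrite gt_eqF //; lra.
have tE : t * (3 * x - y) = 1 / 2 by rewrite /t; field; rewrite gt_eqF //; lra.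
pose low := glue x (line 0 0 x^-1) (line x 1 s).
pose mid := glue (y - x) low (line (y - x) (3 / 2) t).
pose phi := glue (2 * x) mid (line (2 * x) 2 s).
have agree1 : line 0 0 x^-1 x = line x 1 s x.
  by rewrite /line subrr mulr0 subr0 mulVf ?gt_eqF //; lra.
have agree2 : low (y - x) = line (y - x) (3 / 2) t (y - x).
  by rewrite /low glue_r // /line ?subrr; lra.
have agree3 : mid (2 * x) = line (2 * x) 2 s (2 * x).
  by rewrite /mid glue_r // /line ?subrr; lra.
have auto_phi : order_auto phi.
  do 3![apply: glue_auto => //; last by apply: line_auto].
  by apply: line_auto; rewrite invr_gt0.
have [mono_phi _] := auto_phi.
have phi_low r : x <= r -> r <= y - x -> phi r = 1 + s * (r - x).
  move=> xr ryx; rewrite /phi glue_l; last by lra.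
  by rewrite /mid glue_l // /low glue_r.
have phi_high r : 2 * x <= r -> phi r = 2 + s * (r - 2 * x).
  by move=> xr; rewrite /phi glue_r.
have phix : phi x = 1 by rewrite phi_low; lra.
have phiy : phi y = 5 / 2 by rewrite phi_high; lra.
have phiyx : phi (y - x) = 3 / 2 by rewrite phi_low; lra.
apply: (iso_of_order_auto _ _ auto_phi) => //.
  by rewrite /phi glue_l ?/mid ?glue_l ?/low ?glue_l /line; lra.
move=> a b /andP[xa _] /andP[xb _].
have phia : 1 <= phi a by rewrite -phix mono_phi.
have phib : 1 <= phi b by rewrite -phix mono_phi.
have [ayx|ayx] := leP a (y - x); have [byx|byx] := leP b (y - x).
- by rewrite (phi_low a) // (phi_low b) // phi_high; [congr Num.min; lra|lra].
- have : phi (y - x) <= phi b by rewrite mono_phi ltW.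
  by move=> ?; rewrite !min_r //; [lra | rewrite -phiy mono_phi; lra].
- have : phi (y - x) <= phi a by rewrite mono_phi ltW.
  by move=> ?; rewrite !min_r //; [lra | rewrite -phiy mono_phi; lra].
- have : phi (y - x) <= phi a by rewrite mono_phi ltW.
  by move=> ?; rewrite !min_r //; [lra | rewrite -phiy mono_phi; lra].
Qed.
End FromRealMaps.

(** * Real coordinates of an isomorphism *)

Section Coordinates.
Context {R : realType}.
Implicit Types (r s x y : R) (phi : R -> R).

(** The finite part of the carrier, that is the carrier without its zero -oo. *)
Definition trop_real x y : {pred R} := fun r => (r == 0) || (x <= r <= y).

Lemma trop_elt_EFin x y r : trop_elt x y r%:E = (r \in trop_real x y).
Proof. by rewrite /trop_elt orbF !lee_fin orbC. Qed.

Lemma trop_real0 x y : 0 \in trop_real x y.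
Proof. by rewrite unfold_in eqxx. Qed.

Lemma trop_real_itv {x y r} : x <= r <= y -> r \in trop_real x y.
Proof. by rewrite unfold_in => ->; rewrite orbT. Qed.

Lemma trop_real_nz {x y r} : r \in trop_real x y -> r != 0 -> x <= r <= y.
Proof. by case/orP=> [/eqP ->|]; rewrite ?eqxx. Qed.

Lemma trop_real_ge0 {x y r} : 0 <= x -> r \in trop_real x y -> 0 <= r.
Proof. by move=> x0 /orP[/eqP -> //|/andP[xr _]]; exact: le_trans xr. Qed.

Record coordinate_map x y x' y' phi : Prop := CoordinateMap {
  coord_elt : {homo phi : r / r \in trop_real x y >-> r \in trop_real x' y'};
  coord_surj s : s \in trop_real x' y' ->
    exists2 r, r \in trop_real x y & phi r = s;
  coord_mono : {in trop_real x y &, {mono phi : a b / a <= b}};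
  coord0 : phi 0 = 0;
  coord_add : {in trop_real x y &, forall a b,
    phi (Num.min (a + b) y) = Num.min (phi a + phi b) y'} }.

Arguments coord0 {x y x' y' phi}.
Lemma iso_sym {S S' : pzSemiRingType} : S ≅ S' -> S' ≅ S.
Proof.
case=> f [[g fK gK] fD fM]; exists g.
split; first by exists f.
  by move=> a b; apply: (can_inj fK) => /=; rewrite fD !gK.
by move=> a b; apply: (can_inj fK) => /=; rewrite fM !gK.
Qed.

(** The order is definable from the addition, as a <= b iff a + b = b, so an
isomorphism is increasing.  It fixes -oo and 0, being the neutral elements for
addition and multiplication; hence it maps finite elements to finite ones. *)
Lemma iso_coordinates {x y x' y'} {h : 0 <= x < y} {h' : 0 <= x' < y'} :
  trunc_trop x y h ≅ trunc_trop x' y' h' ->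
  exists phi, coordinate_map x y x' y' phi.
Proof.
case=> f [[g fK gK] fD fM].
have finj := can_inj fK.
have f0 : f 0 = 0.
  by have := fD (g 0) 0; rewrite addr0 gK add0r.
have f1 : f 1 = 1.
  by have := fM (g 1) 1; rewrite mulr1 gK mul1r.
have le_add (u v : R) (k : 0 <= u < v) (a b : trunc_trop u v k) :
    (trop_val a <= trop_val b)%E = (a + b == b).
  by rewrite -val_eqE /= eq_maxr.
have fmono a b :
    (trop_val (f a) <= trop_val (f b))%E = (trop_val a <= trop_val b)%E.
  by rewrite !le_add -fD (inj_eq finj).
(* Reals outside the carrier are sent to the unit, an arbitrary choice. *)
pose embed r := insubd (1 : trunc_trop x y h) r%:E.
have embedE r : r \in trop_real x y -> trop_val (embed r) = r%:E.
  by move=> Cr; rewrite insubdK // -topredE /= trop_elt_EFin.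
have realE (u v : R) (k : 0 <= u < v) (a : trunc_trop u v k) :
    a != 0 -> exists2 r, r \in trop_real u v & trop_val a = r%:E.
  case: a => -[r||] p.
  - by move=> _; exists r; rewrite // -trop_elt_EFin.
  - by move=> _; have := p; rewrite /trop_elt leye_eq andbF.
  - by rewrite -val_eqE.
pose phi r := fine (trop_val (f (embed r))).
have phiE r : r \in trop_real x y -> trop_val (f (embed r)) = (phi r)%:E.
  move=> Cr; rewrite /phi; case: (realE _ _ _ (f (embed r))) => [|s _ -> //].
  by rewrite -f0 (inj_eq finj) -val_eqE /= embedE.
exists phi; split.
- by move=> r Cr; rewrite -trop_elt_EFin -phiE //; exact: trop_valP.
- move=> s Cs.
  have Es : trop_elt x' y' s%:E by rewrite trop_elt_EFin.
  pose b := TruncTrop h' Es.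
  case: (realE _ _ _ (g b)) => [|r Cr gr].
    by rewrite -(inj_eq finj) gK f0 -val_eqE.
  have er : embed r = g b by apply: val_inj; rewrite /= gr embedE.
  by exists r => //; rewrite /phi er gK.
- by move=> a b Ca Cb; rewrite -lee_fin -!phiE // fmono !embedE // lee_fin.
- suff E : embed 0 = 1 by rewrite /phi E f1.
  by apply: val_inj; rewrite /= embedE ?trop_real0.
move=> a b Ca Cb.
have Cab : Num.min (a + b) y \in trop_real x y.
  rewrite -trop_elt_EFin EFin_min EFinD.
  by apply: trop_elt_mul; rewrite ?trop_elt_EFin.
apply: EFin_inj; rewrite -phiE // EFin_min EFinD -!phiE //.
rewrite -trop_valM -fM; congr (trop_val (f _)).
by apply: val_inj; rewrite /= !embedE // EFin_min EFinD.
Qed.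

End Coordinates.

Arguments coord_elt {R x y x' y' phi} _ [_].
Arguments coord_surj {R x y x' y' phi} _ {s}.
Arguments coord_mono {R x y x' y' phi}.
Arguments coord0 {R x y x' y' phi}.
Arguments coord_add {R x y x' y' phi}.


Section Invariants.
Context {R : realType}.
Variables (x y x' y' : R) (h : 0 <= x < y) (h' : 0 <= x' < y').
Variables (phi : R -> R) (coord : coordinate_map x y x' y' phi).

Lemma coord_inj : {in trop_real x y &, injective phi}.
Proof. exact: (inc_inj_in (coord_mono coord)). Qed.

Lemma coord_lt : {in trop_real x y &, {mono phi : a b / a < b}}.
Proof. exact: (leW_mono_in (coord_mono coord)). Qed.

Lemma coord_top : phi y = y'.
Proof.
have /andP[x0 xy] := h; have /andP[x'0 xy'] := h'.
have Cy : y \in trop_real x y by rewrite trop_real_itv // lexx ltW.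
have [|r Cr phir] := coord_surj coord (s := y').
  by rewrite trop_real_itv // lexx ltW.
have ry : r <= y by case/orP: Cr => [/eqP ->|/andP[]//]; lra.
apply/eqP; rewrite eq_le -{2}phir (coord_mono coord) // ry andbT.
by case/orP: (coord_elt coord Cy) => [/eqP ->|/andP[]//]; lra.
Qed.

Lemma coord_bottom : 0 < x -> 0 < x' -> phi x = x'.
Proof.
move=> x0 x'0; have /andP[_ xy] := h; have /andP[_ xy'] := h'.
have Cx : x \in trop_real x y by rewrite trop_real_itv // lexx ltW.
have [|r Cr phir] := coord_surj coord (s := x').
  by rewrite trop_real_itv // lexx ltW.
have r0 : r != 0.
  by apply: contra_eq_neq phir => ->; rewrite (coord0 coord) lt_eqF.
have /andP[xr _] := trop_real_nz Cr r0.
apply/eqP; rewrite eq_le -{1}phir (coord_mono coord) // xr /=.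
have: phi x != 0.
  rewrite -(coord0 coord) (inj_in_eq coord_inj) ?trop_real0 //.
  by rewrite gt_eqF.
by move=> /(trop_real_nz (coord_elt coord Cx)) /andP[].
Qed.

(** Truncating the intermediate sums of n copies of a does not affect the final
truncated sum, because a is nonnegative. *)
Lemma coord_muln n a : a \in trop_real x y ->
  Num.min (n%:R * a) y \in trop_real x y /\
  phi (Num.min (n%:R * a) y) = Num.min (n%:R * phi a) y'.
Proof.
have /andP[x0 xy] := h; have /andP[x'0 xy'] := h'.
move=> Ca; have a0 := trop_real_ge0 x0 Ca.
have phia0 := trop_real_ge0 x'0 (coord_elt coord Ca).
have minDmin (t u v : R) : 0 <= t ->
    Num.min (Num.min u v + t) v = Num.min (u + t) v.
  by move=> t0; have [//|vu] := leP u v; rewrite !min_r //; lra.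
elim: n => [|n [Cn IHn]].
  by rewrite !mul0r !min_l ?(coord0 coord) ?trop_real0 //; lra.
rewrite !mulrSr !mulrDl !mul1r; split.
  rewrite -minDmin // -trop_elt_EFin EFin_min EFinD.
  by apply: trop_elt_mul; rewrite ?trop_elt_EFin.
by rewrite -minDmin // (coord_add coord) // IHn minDmin.
Qed.

End Invariants.

Arguments coord_lt {R x y x' y' phi}.
Arguments coord_top {R x y x' y'} h h' {phi}.
Arguments coord_bottom {R x y x' y'} h h' {phi}.
Arguments coord_muln {R x y x' y'} h h' {phi}.

(** * The separating invariants *)

Section NonIsomorphism.
Context {R : realType}.
Implicit Types (x y z : R).

(** If r were the preimage of the least nonzero element x', then r / 2 would have
to be mapped strictly between 0 and x'. *)
Lemma not_iso_dense {y x' y'} (h : 0 <= 0 < y) (h' : 0 <= x' < y') :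
  0 < x' -> ~ (trunc_trop 0 y h ≅ trunc_trop x' y' h').
Proof.
move=> x'0 /iso_coordinates [phi coord].
have /andP[_ xy'] := h'.
have C0 := trop_real0 (0 : R) y.
have [|r Cr phir] := coord_surj coord (s := x').
  by rewrite trop_real_itv // lexx ltW.
have r0 : 0 < r.
  by rewrite -(coord_lt coord) // (coord0 coord) phir.
have /andP[_ ry] := trop_real_nz Cr (lt0r_neq0 r0).
have Ch : r / 2 \in trop_real 0 y by rewrite trop_real_itv //; lra.
have lt0h : 0 < phi (r / 2).
  by rewrite -(coord0 coord) (coord_lt coord) //; lra.
have : phi (r / 2) < x' by rewrite -phir (coord_lt coord) //; lra.
have := trop_real_nz (coord_elt coord Ch) (lt0r_neq0 lt0h).
by lra.
Qed.

Lemma coord_two {y z} {h : 0 <= (1 : R) < y} {h' : 0 <= (1 : R) < z} {phi} :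
  coordinate_map 1 y 1 z phi -> 2 <= y -> 2 <= z -> phi 2 = 2.
Proof.
move=> coord y2 z2; have E : 2 = 1 + 1 :> R by lra.
have C1 : (1 : R) \in trop_real 1 y by rewrite trop_real_itv //; lra.
have := coord_add coord _ _ C1 C1.
by rewrite (coord_bottom h h' coord) // -E (min_l y2) (min_l z2).
Qed.

Lemma not_iso_two_layers {y} (h : 0 <= (1 : R) < y) : 2 < y ->
  ~ (trunc_trop 1 2 (bounds_1_2 R) ≅ trunc_trop 1 y h).
Proof.
move=> y2 /iso_coordinates [phi coord].
have := coord_two (h := bounds_1_2 R) (h' := h) coord (lexx 2) (ltW y2).
by rewrite (coord_top (bounds_1_2 R) h coord); lra.
Qed.

(** In the source 3/2 + 1 is the top, whereas phi (3/2) < phi 2 = 2 implies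
phi (3/2) + phi 1 < 3 <= y. *)
Lemma not_iso_three_layers {y} (h : 0 <= (1 : R) < y) : 3 <= y ->
  ~ (trunc_trop 1 (5 / 2) (bounds_1_52 R) ≅ trunc_trop 1 y h).
Proof.
move=> y3 /iso_coordinates [phi coord].
have C1 : (1 : R) \in trop_real 1 (5 / 2) by rewrite trop_real_itv //; lra.
have C2 : (2 : R) \in trop_real 1 (5 / 2) by rewrite trop_real_itv //; lra.
have C3 : (3 / 2 : R) \in trop_real 1 (5 / 2) by rewrite trop_real_itv //; lra.
have phi1 : phi 1 = 1 by apply: (coord_bottom (bounds_1_52 R) h coord).
have phi2 : phi 2 = 2.
  by apply: (coord_two (h := bounds_1_52 R) (h' := h) coord); lra.
have phi32 : phi (3 / 2) < phi 2 by rewrite (coord_lt coord) //; lra.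
rewrite phi2 in phi32.
have := coord_add coord _ _ C3 C1.
rewrite phi1 min_r; last by lra.
rewrite (coord_top (bounds_1_52 R) h coord) min_l; lra.
Qed.

(** * Rigidity for bounds at least 3 *)

(** Put e i = 1 + i / N.  Since e (i + 1) + e 0 = e i + e 1, the values phi (e i)
form an arithmetic progression, as long as the sums on the target side are not
truncated; this holds because phi (e (i + 1)) + 1 <= phi 2 + 1 = 3 < z.  The
progression goes from phi 1 = 1 to phi 2 = 2 in N steps. *)
Lemma coord_rational {y z} {h : 0 <= (1 : R) < y} {h' : 0 <= (1 : R) < z}
    {phi k N} :
    coordinate_map 1 y 1 z phi -> 3 <= y -> 3 < z -> (k <= N)%N ->
  phi (1 + k%:R / N%:R) = 1 + k%:R / N%:R.
Proof.
move=> coord y3 z3.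
(* For N = 0 also k = 0, and k / N = 0. *)
case: (posnP N) => [->|N0].
  by rewrite leqn0 => /eqP ->; rewrite mul0r addr0 (coord_bottom h h' coord).
have C1 : (1 : R) \in trop_real 1 y by rewrite trop_real_itv //; lra.
have C2 : (2 : R) \in trop_real 1 y by rewrite trop_real_itv //; lra.
have phi1 : phi 1 = 1 by apply: (coord_bottom h h' coord).
have phi2 : phi 2 = 2 by apply: (coord_two (h := h) (h' := h') coord); lra.
have N0R : 0 < N%:R :> R by rewrite ltr0n.
pose e i : R := 1 + i%:R / N%:R.
have e0 : e 0 = 1 by rewrite /e mul0r addr0.
have eN : e N = 2 by rewrite /e divff ?gt_eqF //; lra.
have e_itv i : (i <= N)%N -> 1 <= e i <= 2.
  move=> iN; rewrite /e lerDl divr_ge0 ?ler0n //=.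
  have : i%:R / N%:R <= 1 :> R by rewrite ler_pdivrMr // mul1r ler_nat.
  by lra.
have Ce i : (i <= N)%N -> e i \in trop_real 1 y.
  by move=> /e_itv /andP[e1 e2]; rewrite trop_real_itv // e1; lra.
have step i : (i < N)%N -> phi (e i.+1) + 1 = phi (e i) + phi (e 1).
  move=> iN; have Ci := Ce _ iN.
  have le2 : phi (e i.+1) <= 2.
    by rewrite -phi2 (coord_mono coord) //; have /andP[] := e_itv _ iN.
  have eE : e i.+1 + 1 = e i + e 1 by rewrite /e -addn1 natrD; ring.
  have := coord_add coord _ _ Ci C1.
  rewrite eE (coord_add coord) ?Ce ?(ltnW iN) // phi1 [RHS]min_l; last by lra.
  (* The two sums agree up to truncation at z, and the first is below z. *)
  by case: leP => _; lra.
have arith i : (i <= N)%N -> phi (e i) = 1 + i%:R * (phi (e 1) - 1).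
  elim: i => [|i IHi] iN; first by rewrite e0 phi1 mul0r addr0.
  by have := step i iN; rewrite IHi ?(ltnW iN) // -addn1 natrD mulrDl; lra.
have slope : phi (e 1) - 1 = N%:R^-1.
  have := arith N (leqnn N); rewrite eN phi2 => E.
  by apply: (mulfI (lt0r_neq0 N0R)); rewrite divff ?gt_eqF //; lra.
by move=> kN; rewrite -/(e k) arith // slope.
Qed.

Lemma exists_nat_frac (a b : R) : 0 <= a -> a < b -> b <= 1 ->
  exists k N, (k <= N)%N /\ a < k%:R / N%:R < b.
Proof.
move=> a0 ab b1; have [q] := rat_in_itvoo ab; rewrite in_itv /= => /andP[aq qb].
have q0 : 0 <= q by rewrite -(ler0q R) ltW // (le_lt_trans a0).
have qE : ratr q = `|numq q|%:R / `|denq q|%:R :> R.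
  by rewrite !natr_absz /ratr !ger0_norm ?numq_ge0 ?denq_ge0.
exists `|numq q|%N, `|denq q|%N; rewrite -qE aq qb; split=> //.
have d0 : 0 < (`|denq q|%N)%:R :> R by rewrite ltr0n absz_gt0 denq_neq0.
by rewrite -(ler_nat R) -[leRHS]mul1r -ler_pdivrMr // -qE; lra.
Qed.

(** If y < z, choose c = 1 + k / N fixed by phi and n with y < n c < z: the n-fold
truncated sum of c is the top y in the source, but n c < z in the target. *)
Lemma iso_bound_le {y z} {h : 0 <= (1 : R) < y} {h' : 0 <= (1 : R) < z} : 3 <= y ->
  trunc_trop 1 y h ≅ trunc_trop 1 z h' -> z <= y.
Proof.
move=> y3 /iso_coordinates [phi coord]; rewrite leNgt; apply/negP => yz.
(* With n the integer part of y we have 1 <= y / n < 2, so that c can be found in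
   the interval between y / n and the minimum of z / n and 2. *)
pose n := Num.truncn y.
have /andP[ny yn] : n%:R <= y < n.+1%:R by apply: truncn_itv; lra.
have n1 : (1 <= n)%N by rewrite -ltnS -(ltr_nat R); lra.
have n1R : 1 <= n%:R :> R by rewrite ler1n.
have n0R : 0 < n%:R :> R by lra.
rewrite -addn1 natrD in yn.
have [||| k [N [kN /andP[ltk gtk]]]] :=
    exists_nat_frac (y / n%:R - 1) (Num.min (z / n%:R) 2 - 1).
- by rewrite subr_ge0 ler_pdivlMr // mul1r.
- rewrite ltrD2r lt_min ltr_pM2r ?invr_gt0 // yz /=.
  by rewrite ltr_pdivrMr //; lra.
- have : Num.min (z / n%:R) 2 <= 2 by rewrite ge_min lexx orbT.
  by lra.
pose c : R := 1 + k%:R / N%:R.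
have [yc cz c2] : [/\ y < n%:R * c, n%:R * c < z & c < 2].
  have := ltk; rewrite ltrBlDl ltr_pdivrMr // mulrC => ->.
  have : c < Num.min (z / n%:R) 2 by rewrite /c; lra.
  by rewrite lt_min ltr_pdivlMr // mulrC => /andP[-> ->].
have c1 : 1 <= c by rewrite /c lerDl divr_ge0.
have Cc : c \in trop_real 1 y by rewrite trop_real_itv // c1; lra.
have [_] := coord_muln h h' coord n c Cc.
rewrite (coord_rational (h := h) (h' := h') coord) //; last by lra.
by rewrite (min_r (ltW yc)) (min_l (ltW cz)) (coord_top h h' coord); lra.
Qed.

End NonIsomorphism.

Theorem theorem4p1 (R : realType) :
  (forall (x y : R) (h : 0 <= x < y),
    [/\ x = 0 ->
          trunc_trop x y h ≅ trunc_trop 0 1 (bounds_0_1 R),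
        0 < x -> y <= 2 * x ->
          trunc_trop x y h ≅ trunc_trop 1 2 (bounds_1_2 R),
        0 < x -> 2 * x < y -> y < 3 * x ->
          trunc_trop x y h ≅ trunc_trop 1 (5 / 2) (bounds_1_52 R)
      & forall (x_gt0 : 0 < x) (y_ge3x : 3 * x <= y),
          trunc_trop x y h ≅
          trunc_trop 1 (y / x) (bounds_1_div x_gt0 y_ge3x)])
  /\
  [/\ ~ (trunc_trop 0 1 (bounds_0_1 R) ≅ trunc_trop 1 2 (bounds_1_2 R)),
      ~ (trunc_trop 0 1 (bounds_0_1 R) ≅
         trunc_trop 1 (5 / 2) (bounds_1_52 R)),
      ~ (trunc_trop 1 2 (bounds_1_2 R) ≅
         trunc_trop 1 (5 / 2) (bounds_1_52 R)),
      forall (y : R) (y_ge3 : 3 <= y),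
        [/\ ~ (trunc_trop 0 1 (bounds_0_1 R) ≅
               trunc_trop 1 y (bounds_1_ge3 y_ge3)),
            ~ (trunc_trop 1 2 (bounds_1_2 R) ≅
               trunc_trop 1 y (bounds_1_ge3 y_ge3))
          & ~ (trunc_trop 1 (5 / 2) (bounds_1_52 R) ≅
               trunc_trop 1 y (bounds_1_ge3 y_ge3))]
    & forall (y z : R) (y_ge3 : 3 <= y) (z_ge3 : 3 <= z), y <> z ->
        ~ (trunc_trop 1 y (bounds_1_ge3 y_ge3) ≅
           trunc_trop 1 z (bounds_1_ge3 z_ge3))].
Proof.
split=> [x y h|].
  have /andP[x0 xy] := h; split.
  - move=> x_eq0; subst x; apply: (iso_scale y^-1); rewrite ?invr_gt0 //.
      by rewrite mulr0.
    by rewrite mulVf // gt_eqF.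
  - exact: iso_two_layers.
  - exact: iso_three_layers.
  - move=> x_gt0 y_ge3x; apply: (iso_scale x^-1); rewrite ?invr_gt0 //.
      by rewrite mulVf // gt_eqF.
    exact: mulrC.
split.
- by apply: not_iso_dense; lra.
- by apply: not_iso_dense; lra.
- by apply: not_iso_two_layers; lra.
- move=> y y3; split.
  + by apply: not_iso_dense; lra.
  + by apply: not_iso_two_layers; lra.
  + exact: not_iso_three_layers.
move=> y z y3 z3 yz iso_yz; apply: yz; apply/eqP; rewrite eq_le.
by rewrite (iso_bound_le z3 (iso_sym iso_yz)) (iso_bound_le y3 iso_yz).
Qed.
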